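(* Let $0<\gamma\le 1$ and consider, in the domain $\Omega=\{(t,x): x<0,\ t>0\}$, the dimensionless piston problem with Mach number $M_0$ for a piston moving into the gas ($v_0=-1$): $$\rho_t+(\rho u)_x=0,\qquad u_t+\Big(\tfrac{u^2}{2}+\int^{\rho}\tfrac{P'(s)}{s}\,ds\Big)_x=0,\qquad P(\rho)=-\frac{1}{\gamma M_0^2\rho^{\gamma}},$$ with initial data $(\rho,u)|_{t=0}=(\rho_0,u_0)=(1,1)$ for $x<0$ (since $u_0=-v_0$) and boundary condition $u=0$ on $x=0$. There are two situations: (1) A shock wave solution of this problem (as described in the context) exists only for Mach numbers satisfying $M_0\in\big(0,\sqrt{2}\,(1+\gamma)^{-1/2}\big)$. (2) If $M_0\ge\sqrt{2}\,(1+\gamma)^{-1/2}$, then there is a Radon measure solution, in the sense of the definition of measure solution in the context, to the problem in the domain $\Omega$.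
   Context: Physical origin: the system is the one-dimensional compressible fluid flow system for a generalized Chaplygin gas, with density $\rho$, velocity $u$ and pressure $P$, in nondimensional form. Here $\int^\rho\frac{P'(s)}{s}ds=-\frac{1}{(1+\gamma)M_0^2}\rho^{-(1+\gamma)}$. The gas is initially uniform and at rest, with $\rho_0=1$ and $P_0=-\frac{1}{\gamma M_0^2}$. The piston moves with constant velocity $v_0=\pm1$, and coordinates are attached to the piston, so that the piston is at $x=0$, the gas is in $x<0$, and the initial gas velocity is $u_0=-v_0$. $M_0$ is the ratio of the piston speed to the initial sound speed. Integral solution: a pair $(\rho,u)\in L^\infty([0,\infty)\times(-\infty,0])$ such that for all $\phi\in C_0^1(\mathbb R^2)$ (compactly supported $C^1$ functions of $(t,x)$), $$\int_\Omega(\rho\,\partial_t\phi+\rho u\,\partial_x\phi)\,dxdt+\int_{-\infty}^0\rho_0\,\phi(0,x)\,dx=0,$$ $$\int_\Omega\Big[u\,\partial_t\phi+\Big(\tfrac{u^2}{2}+\int^\rho\tfrac{P'(s)}{s}ds\Big)\partial_x\phi\Big]dxdt-\int_0^\infty \int^\rho\tfrac{P'(s)}{s}ds\Big|_{x=0}\,\phi(t,0)\,dt+\int_{-\infty}^0u_0\,\phi(0,x)\,dx=0.$$ Shock wave solution (for $v_0=-1$): an integral solution of the self-similar, piecewise constant form $(\rho,u)(t,x)=(1,1)$ for $x/t<\sigma$ and $(\rho,u)(t,x)=(\rho_1,0)$ for $\sigma<x/t\le0$, where $\sigma<0$, and the two states and $\sigma$ satisfy the Rankine–Hugoniot conditions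 (the first of which, $\sigma(\rho_1-1)=-1$, forces $\rho_1>1$). Measures: $\mathcal L^2$ is Lebesgue measure on $\mathbb R^2$; $\langle m,\phi\rangle=\int\phi\,dm$; $\mu\ll\nu$ means $\mu$ is absolutely continuous with respect to $\nu$. For a locally integrable $w$ on $[0,\infty)$, the weighted Dirac measure supported on the piston is given by $\langle w\,\delta_{\{x=0,\,t\ge0\}},\phi\rangle=\int_0^\infty w(t)\,\phi(t,0)\,dt$. Measure solution: for fixed $0<M_0\le\infty$, let $\varrho,m,n,\tau,\mathcal P$ be Radon measures on $\overline\Omega$ and $w_p$ a locally integrable nonnegative function on $[0,\infty)$. Then $(\varrho,u,w_p)$ is called a measure solution of the piston problem provided that: i) $m\ll\varrho$ and $\tau\ll n$, and they have the same Radon–Nikodym derivative $u$, namely $u=\frac{m(dxdt)}{\varrho(dxdt)}=\frac{\tau(dxdt)}{n(dxdt)}$; ii) for every $\phi\in C_0^1(\mathbb R^2)$, $$\langle\varrho,\partial_t\phi\rangle+\langle m,\partial_x\phi\rangle+\int_{-\infty}^0\rho_0\,\phi(0,x)\,dx=0,$$ $$\langle n,\partial_t\phi\rangle+\langle\tau,\partial_x\phi\rangle+\langle\mathcal P,\partial_x\phi\rangle-\langle w_p\,\delta_{\{x=0,\,t\ge0\}},\phi\rangle+\int_{-\infty}^0u_0\,\phi(0,x)\,dx=0;$$ iii) if $\varrho\ll\mathcal L^2$ with derivative $\rho(t,x)$ in a neighbourhood of $(t,x)\in[0,\infty)\times(-\infty,0]$, and $\mathcal P\ll\mathcal L^2$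 with derivative $P(t,x)$ there, then $\mathcal L^2$-a.e. $P=-\frac{1}{\rho^{\gamma}}\frac{1}{\gamma M_0^2}$, and in addition the classical entropy condition holds for discontinuities of the functions $\rho,u$ near $(t,x)$. *)

(* Defs.v *)
From HB Require Import structures.
From mathcomp Require Import all_boot all_order all_algebra.
From mathcomp Require Import all_classical all_reals all_analysis.

Set Implicit Arguments.
Unset Strict Implicit.
Unset Printing Implicit Defensive.

Import Order.TTheory GRing.Theory Num.Theory.
Import numFieldNormedType.Exports.

Local Open Scope classical_set_scope.
Local Open Scope ring_scope.

(* Points of the plane are pairs (t, x): time first, space second. The factors
   are measurableTypeR R, on which lebesgue_measure is defined. *)
Notation plane R := (measurableTypeR R * measurableTypeR R)%type.

Section geometry.
Context (R : realType).

Definition Omega : set (plane R) := [set p | 0 < p.1 /\ p.2 < 0].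

Definition Omega_bar : set (plane R) := [set p | 0 <= p.1 /\ p.2 <= 0].

Definition leb2 : {measure set (plane R) -> \bar R} :=
  (@lebesgue_measure R \x @lebesgue_measure R)%E.

Definition d_t (phi : plane R -> R) (p : plane R) : R :=
  derive1 (fun s : R => phi (s, p.2)) p.1.

Definition d_x (phi : plane R -> R) (p : plane R) : R :=
  derive1 (fun y : R => phi (p.1, y)) p.2.

(* C^1_0(R^2); the support may meet the lines t = 0 and x = 0. *)
Definition C1_0 (phi : plane R -> R) : Prop :=
  [/\ continuous phi,
      forall p : plane R, derivable (fun s : R => phi (s, p.2)) p.1 1 /\
                derivable (fun y : R => phi (p.1, y)) p.2 1,
      continuous (d_t phi), continuous (d_x phi) &
      exists2 K : set (plane R), compact K & forall p, ~ K p -> phi p = 0].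

Definition loc_integrable_time (w : R -> R) : Prop :=
  forall T : R, 0 < T ->
    (@lebesgue_measure R).-integrable `[0, T] (EFin \o w).

Definition loc_integrable_Omega_bar (w : plane R -> R) : Prop :=
  forall K : set (plane R), compact K -> K `<=` Omega_bar ->
    leb2.-integrable K (EFin \o w).

Definition Linfty_Omega_bar (f : plane R -> R) : Prop :=
  measurable_fun Omega_bar f /\ finite_norm leb2 +oo%E (f \_ Omega_bar).

End geometry.

Section gas.
Context (R : realType) (gamma : R) (M0 : \bar R).

(* 1 / M0, equal to 0 for M0 = +oo. *)
Definition inv_Mach : R := fine (M0^-1)%E.

Definition pressure (rho : R) : R :=
  - (inv_Mach ^+ 2 / gamma) * rho `^ (- gamma).

(* \int^rho P'(s)/s ds, with the constant of integration that makes it vanish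
   at rho = +oo. *)
Definition enthalpy (rho : R) : R :=
  - (inv_Mach ^+ 2 / (1 + gamma)) * rho `^ (- (1 + gamma)).

(* sqrt (P'(rho)) *)
Definition sound_speed (rho : R) : R :=
  inv_Mach * rho `^ (- ((1 + gamma) / 2)).

(* The characteristic speeds. *)
Definition lambda1 (s : R * R) : R := s.2 - sound_speed s.1.
Definition lambda2 (s : R * R) : R := s.2 + sound_speed s.1.

(* A state is a pair (rho, u); l is the state on the side x < xi(t) and r the
   one on the side x > xi(t). *)
Definition rankine_hugoniot (sigma : R) (l r : R * R) : Prop :=
  sigma * (r.1 - l.1) = r.1 * r.2 - l.1 * l.2 /\
  sigma * (r.2 - l.2) =
    (r.2 ^+ 2 / 2 + enthalpy r.1) - (l.2 ^+ 2 / 2 + enthalpy l.1).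

(* Lax' entropy condition. The last two cases are the contact discontinuities,
   which are admissible; they occur for gamma = 1 (Chaplygin gas), where both
   characteristic fields are linearly degenerate, and for M0 = +oo. *)
Definition lax_admissible (sigma : R) (l r : R * R) : Prop :=
  [\/ [/\ lambda1 r < sigma, sigma < lambda1 l & sigma < lambda2 r],
      [/\ lambda2 r < sigma, sigma < lambda2 l & lambda1 l < sigma],
      lambda1 l = sigma /\ lambda1 r = sigma |
      lambda2 l = sigma /\ lambda2 r = sigma].

End gas.

Section integral_solutions.
Context (R : realType) (gamma : R) (M0 : \bar R) (v0 : R).

Definition rho_init : R := 1.
Definition u_init : R := - v0.

Definition strip (T e : R) : set (plane R) :=
  [set p | 0 <= p.1 <= T /\ - e <= p.2 <= 0].

(* b is the trace of w on the piston x = 0, in the L^1_loc sense; this does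
   not depend on the choice of w in its class modulo Lebesgue-null sets. *)
Definition piston_trace (w : plane R -> R) (b : R -> R) : Prop :=
  loc_integrable_time b /\
  forall T : R, 0 < T ->
    ((e^-1)%:E * \int[@leb2 R]_(p in strip T e) `|w p - b p.1|%:E)%E
      @[e --> (0 : R)^'+] --> 0%E.

(* The positivity of rho and the local integrability of the enthalpy, together
   with the existence of its trace, are what gives the integrals a meaning. *)
Definition integral_solution (rho u : plane R -> R) : Prop :=
  let h p := enthalpy gamma M0 (rho p) in
  [/\ Linfty_Omega_bar rho, Linfty_Omega_bar u,
      {ae @leb2 R, forall p, Omega p -> 0 < rho p},
      loc_integrable_Omega_bar h &
      exists2 b : R -> R, piston_trace h b &
      forall phi, C1_0 phi ->
        \int[@leb2 R]_(p in @Omega R)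
           (rho p * d_t phi p + rho p * u p * d_x phi p)
        + \int[@lebesgue_measure R]_(x in `]-oo, 0]) (rho_init * phi (0, x))
        = 0 /\
        \int[@leb2 R]_(p in @Omega R)
           (u p * d_t phi p + (u p ^+ 2 / 2 + h p) * d_x phi p)
        - \int[@lebesgue_measure R]_(t in `[0, +oo[) (b t * phi (t, 0))
        + \int[@lebesgue_measure R]_(x in `]-oo, 0]) (u_init * phi (0, x))
        = 0].

End integral_solutions.

(* For v0 = -1, i.e. initial velocity 1. *)
Definition shock_wave_solution (R : realType) (gamma : R) (M0 : \bar R)
    (rho u : plane R -> R) : Prop :=
  exists rho1 sigma : R,
    [/\ sigma < 0,
        forall t x : R, 0 < t -> x <= 0 ->
          (x / t < sigma -> rho (t, x) = 1 /\ u (t, x) = 1) /\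
          (sigma < x / t -> rho (t, x) = rho1 /\ u (t, x) = 0),
        rankine_hugoniot gamma M0 sigma (1, 1) (rho1, 0) &
        integral_solution gamma M0 (-1) rho u].

Section radon_measures.
Context (R : realType).
Local Notation measure2 := ({measure set (plane R) -> \bar R}).

(* Positive Radon measures on Omega_bar, seen as measures on the plane carried
   by Omega_bar. A Borel measure on the plane which is finite on compact sets
   is automatically regular. *)
Definition radon (mu : measure2) : Prop :=
  mu (~` @Omega_bar R) = 0%E /\ forall K : set (plane R), compact K -> (mu K < +oo)%E.

(* A signed measure mu is encoded by its Jordan decomposition (mu^+, mu^-).
   The charges of the library are finite on all sets, which excludes signed
   Radon measures such as -leb2; see signed_radon for the requirements. *)
Definition smeasure : Type := (measure2 * measure2)%type.

Definition signed_radon (mu : smeasure) : Prop :=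
  [/\ radon mu.1, radon mu.2 &
      exists2 N, measurable N & mu.1 N = 0%E /\ mu.2 (~` N) = 0%E].

Definition of_measure (mu : measure2) : smeasure := (mu, [the measure2 of mzero]).

(* |mu| = mu^+ + mu^- *)
Definition variation_measure (mu : smeasure) : measure2 :=
  measure_add mu.1 mu.2.

(* Meaningful when A has compact closure. *)
Definition signed_value (mu : smeasure) (A : set (plane R)) : R :=
  fine (mu.1 A) - fine (mu.2 A).

Definition signed_integral (mu : smeasure) (A : set (plane R)) (f : plane R -> R) : R :=
  \int[mu.1]_(p in A) f p - \int[mu.2]_(p in A) f p.

Definition pairing (mu : smeasure) (phi : plane R -> R) : R :=
  signed_integral mu (@Omega_bar R) phi.

Definition abs_cont (mu nu : smeasure) : Prop :=
  variation_measure mu `<< variation_measure nu.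

(* On V, mu << nu with Radon-Nikodym derivative f. *)
Definition RN_derivative_on (V : set (plane R)) (mu nu : smeasure)
    (f : plane R -> R) : Prop :=
  measurable_fun V f /\
  forall A K : set (plane R), measurable A -> compact K -> A `<=` K -> A `<=` V ->
    (variation_measure nu).-integrable A (EFin \o f) /\
    signed_value mu A = signed_integral nu A f.

(* w \delta_{x = 0, t >= 0} *)
Definition piston_dirac (w : R -> R) (phi : plane R -> R) : R :=
  \int[@lebesgue_measure R]_(t in `[0, +oo[) (w t * phi (t, 0)).

End radon_measures.

Section measure_solutions.
Context (R : realType) (gamma : R) (M0 : \bar R) (v0 : R).

(* Essential limit at q along S: insensitive to Lebesgue-null modifications. *)
Definition ess_limit (S : set (plane R)) (f : plane R -> R) (q : R * R) (l : R) :
    Prop :=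
  forall e : R, 0 < e -> exists V, open_nbhs q V /\
    {ae @leb2 R, forall y, V y -> S y -> `|f y - l| < e}.

(* The entropy condition at every jump of (rho, u) across a C^1 curve
   x = xi(t) in V. *)
Definition entropy_condition_on (V : set (plane R)) (rho u : plane R -> R) : Prop :=
  forall (xi : R -> R) (t0 : R) (l r : R * R),
    let q := (t0, xi t0) in
    let left_side := [set y : R * R | y.2 < xi y.1] in
    let right_side := [set y : R * R | xi y.1 < y.2] in
    (\forall t \near t0, derivable xi t 1) -> {for t0, continuous (derive1 xi)} ->
    V q -> Omega q ->
    ess_limit left_side rho q l.1 -> ess_limit left_side u q l.2 ->
    ess_limit right_side rho q r.1 -> ess_limit right_side u q r.2 ->
    l <> r ->
    lax_admissible gamma M0 (derive1 xi t0) l r.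

(* P = P(rho); a vacuum has no finite pressure unless M0 = +oo. *)
Definition state_equation (rho P : R) : Prop :=
  ((M0 < +oo)%E -> 0 < rho) /\ P = pressure gamma M0 rho.

Definition measure_solution (varrho : {measure set (plane R) -> \bar R})
    (u : plane R -> R) (w_p : R -> R) : Prop :=
  [/\ radon varrho,
      loc_integrable_time w_p, forall t : R, 0 <= t -> 0 <= w_p t &
  exists m n tau P : smeasure R,
    [/\ [/\ signed_radon m, signed_radon n, signed_radon tau & signed_radon P],
     [/\ abs_cont m (of_measure varrho), abs_cont tau n,
         RN_derivative_on (@Omega_bar R) m (of_measure varrho) u &
         RN_derivative_on (@Omega_bar R) tau n u],
     forall phi, C1_0 phi ->
       pairing (of_measure varrho) (d_t phi) + pairing m (d_x phi)
       + \int[@lebesgue_measure R]_(x in `]-oo, 0]) (@rho_init R * phi (0, x))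
       = 0 /\
       pairing n (d_t phi) + pairing tau (d_x phi) + pairing P (d_x phi)
       - piston_dirac w_p phi
       + \int[@lebesgue_measure R]_(x in `]-oo, 0]) (u_init v0 * phi (0, x))
       = 0 &
     forall p U (rho Pd : plane R -> R),
       Omega_bar p -> open_nbhs p U ->
       let V := U `&` @Omega_bar R in
       RN_derivative_on V (of_measure varrho) (of_measure (@leb2 R)) rho ->
       RN_derivative_on V P (of_measure (@leb2 R)) Pd ->
       {ae @leb2 R, forall q, V q -> state_equation (rho q) (Pd q)} /\
       entropy_condition_on V rho u]].

End measure_solutions.

(* Main.v *)
Require Import Defs.
From HB Require Import structures.
From mathcomp Require Import all_boot all_order all_algebra.
From mathcomp Require Import all_classical all_reals all_analysis.
From mathcomp Require Import measurable_realfun lra.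

Import Order.TTheory GRing.Theory Num.Theory.
Import numFieldNormedType.Exports.

Local Open Scope classical_set_scope.
Local Open Scope ring_scope.

(** Let c = 1 / ((1 + gamma) M0^2), so that the threshold
    M0 < sqrt 2 (1 + gamma)^(-1/2) says that c > 1/2.

    Shock waves. The second Rankine-Hugoniot relation becomes
    1/2 - sigma = c (1 - rho1^-(1 + gamma)). Since sigma < 0, this forces
    1/2 < c (shock_strength, Mach_lt_threshold).

    Measure solutions. For larger Mach numbers the enthalpy is too weak to
    detach a shock from the piston. Every particle keeps the velocity 1 until
    it reaches the piston and sticks to it. The gas in flight is the Lebesgue
    measure L of the closed quadrant (bulk_measure), and the gas stuck at time
    t has mass t, which gives the weighted Dirac measure with weight t on the
    piston (piston_measure). The solution is

      varrho = L + t delta,   m = L,   n = L + a t delta,   tau = L,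
      P = P0 L,   u = 1 for x < 0 and u = 0 on the piston,

    where P0 is the pressure at density 1. The relations m = u varrho and
    tau = u n hold because u selects the part off the piston
    (RN_derivative_gas_velocity).

    Weak form. By Fubini's theorem and the fundamental theorem of calculus on
    lines, the integral of d_t phi against L is minus the integral of the
    initial trace of phi, that of d_x phi is the integral of the piston trace,
    and that of d_t phi against t delta is minus the integral of the piston
    trace (integral_d_t, integral_d_x, integral_piston_d_t). For the last one
    t delta is seen as the image of the Lebesgue measure of the set
    0 <= x <= t under the projection to the piston, so that no integration by
    parts is needed. The first equation follows, and the second one reduces to
    1 + P0 = a + w_p, which defines a once the force w_p is chosen
    (momentum_balance). The choice is w_p = 1/2 - c, the flux
    u^2 / 2 + enthalpy of the incoming gas; it is nonnegative exactly when M0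
    is at least the threshold.

    State equation and entropy. Wherever varrho and P have Lebesgue densities,
    these are 1 and P0 almost everywhere, since the piston is a null line
    (RN_derivative_cst). The state equation follows, and as rho and u are
    constant off the piston no curve in the open quadrant carries a jump
    (entropy_condition_cst). *)

Set Implicit Arguments.
Unset Strict Implicit.

(** * The Mach number threshold *)
Section mach.
Context {R : realType} (gamma : R) (M0 : \bar R).
Hypotheses (gamma_gt0 : 0 < gamma) (M0_gt0 : (0 < M0)%E).

(** Squaring turns the threshold into a bound on the enthalpy of the gas at
    density 1: the kinetic energy 1/2 of the incoming gas is smaller than
    - enthalpy 1 exactly for Mach numbers below the threshold. *)
Lemma Mach_lt_threshold :
  (M0 < (Num.sqrt 2 * (1 + gamma) `^ (- (1 / 2)))%:E)%E =
  (1 / 2 < inv_Mach M0 ^+ 2 / (1 + gamma)).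
Proof.
have g1 : 0 < 1 + gamma by rewrite addr_gt0.
rewrite mul1r powRN powR12_sqrt ?ltW//.
have s1 : 0 < Num.sqrt (1 + gamma) by rewrite sqrtr_gt0.
rewrite /inv_Mach; case: M0 M0_gt0 => [m| |]//=.
  rewrite lte_fin => m0.
  rewrite inver gt_eqF//= lte_fin [LHS]ltr_pdivlMr// [RHS]ltr_pdivlMr//.
  rewrite exprVn -[m ^- 2]mul1r [RHS]ltr_pdivlMr ?exprn_gt0//.
  rewrite -(@ltr_pXn2r _ 2) ?nnegrE ?mulr_ge0 ?sqrtr_ge0 ?(ltW m0)//.
  rewrite exprMn !sqr_sqrtr ?(ltW g1)//.
  by rewrite mulrC -mulrA ltr_pdivrMl// mulr1 mulrC.
move=> _; rewrite expr0n/= mul0r.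
by rewrite ltNge leey/= ltNge invr_ge0 ler0n.
Qed.

End mach.

Section shock.
Context {R : realType} (gamma : R) (M0 : \bar R).
Hypotheses (gamma_gt0 : 0 < gamma).

(** With c = 1 / ((1 + gamma) M0^2), the second jump relation reads
    1/2 - sigma = c (1 - rho1^-(1 + gamma)); its left side exceeds 1/2 while
    its right side is at most c. *)
Lemma shock_strength (rho1 sigma : R) : sigma < 0 ->
  rankine_hugoniot gamma M0 sigma (1, 1) (rho1, 0) ->
  1 / 2 < inv_Mach M0 ^+ 2 / (1 + gamma).
Proof.
move=> s0; rewrite /rankine_hugoniot /= /enthalpy powR1 => -[_ bernoulli].
set c := inv_Mach M0 ^+ 2 / (1 + gamma) in bernoulli *.
have c0 : 0 <= c by rewrite divr_ge0 ?sqr_ge0// addr_ge0// ltW.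
have := powR_ge0 rho1 (- (1 + gamma)).
set z := rho1 `^ _ in bernoulli *; nra.
Qed.
End shock.

(** * Borel sets and boxes of the plane *)
Section plane_topology.
Context {R : realType}.
Implicit Types (U K : set (plane R)) (f : plane R -> R).

(** The sigma-algebra of the plane is the product one, so that an open set has
    to be written as a countable union of rational squares. *)
Lemma open_measurable_plane U : open U -> measurable U.
Proof.
move=> oU.
pose B (n : nat) (a b : rat) : set (plane R) :=
  ball (ratr a : R) n.+1%:R^-1 `*` ball (ratr b : R) n.+1%:R^-1.
pose F n a b := if pselect (B n a b `<=` U) then B n a b else set0.
have -> : U = \bigcup_n \bigcup_a \bigcup_b F n a b.
  apply/seteqP; split=> [p Up|p [n _ [a _ [b _]]]]; last first.
    by rewrite /F; case: pselect => [sub /= /sub|].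
  have /nbhs_ballP[e /= e0 eU] : nbhs p U by exact: open_nbhs_nbhs.
  have [n _ ne] : \forall n \near \oo, (n.+1%:R^-1 : R) < e / 2.
    exact: (near_infty_natSinv_lt (PosNum (divr_gt0 e0 (ltr0n _ 2)))).
  have {}ne := ne n (leqnn n).
  have rat_near (z : R) : exists a : rat, `|ratr a - z| < n.+1%:R^-1.
    have [|a] := @rat_in_itvoo R (z - n.+1%:R^-1) (z + n.+1%:R^-1).
      by rewrite ltrBlDr -addrA ltrDl addr_gt0.
    by rewrite in_itv/= => az; exists a; rewrite ltr_distl.
  have [[a az] [b bz]] := (rat_near p.1, rat_near p.2).
  exists n => //; exists a => //; exists b => //.
  have Bab : B n a b p by split.
  rewrite /F; case: pselect => // -[]; move=> q [qa qb]; apply: eU.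
  split; rewrite /ball/=.
    rewrite (le_lt_trans (ler_distD (ratr a) _ _))// distrC.
    by rewrite (splitr e) ltrD// (lt_trans _ ne)//; exact: qa.
  rewrite (le_lt_trans (ler_distD (ratr b) _ _))// distrC.
  by rewrite (splitr e) ltrD// (lt_trans _ ne)//; exact: qb.
apply: bigcupT_measurable => n; apply: bigcupT_measurable_rat => a.
apply: bigcupT_measurable_rat => b; rewrite /F; case: pselect => [sub|nsub] //=.
by apply: measurableX; exact: measurable_ball.
Qed.

Lemma continuous_measurable_plane f : continuous f -> measurable_fun setT f.
Proof.
move=> /continuousP cf; apply: (measurability _ (RGenOpens.measurableE R)).
move=> _ [_ [a [b ->]] <-]; rewrite setTI; apply: open_measurable_plane.
by apply: cf; exact: interval_open.
Qed.

Lemma compact_measurable_plane K : compact K -> measurable K.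
Proof.
move=> cK; rewrite -[K]setCK; apply: measurableC; apply: open_measurable_plane.
by apply: closed_openC; exact: compact_closed.
Qed.

Definition box (N : R) : set (plane R) := `[- N, N]%classic `*` `[- N, N]%classic.

Lemma measurable_box N : measurable (box N).
Proof. by apply: measurableX; exact: measurable_itv. Qed.

Lemma boxP N (p : plane R) : box N p <-> `|p.1| <= N /\ `|p.2| <= N.
Proof. by rewrite /box/= !in_itv/= -!ler_norml; split => -[]. Qed.

Lemma compact_box N : compact (box N).
Proof. by apply: compact_setX; exact: segment_compact. Qed.

Lemma compact_sub_box K : compact K -> exists2 N : R, 0 < N & K `<=` box N.
Proof.
move=> cK.
have /compact_bounded [M1 [_ b1]] : compact ((fst : plane R -> R) @` K).
  apply: continuous_compact => //; apply: continuous_subspaceT => p.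
  exact: cvg_fst.
have /compact_bounded [M2 [_ b2]] : compact ((snd : plane R -> R) @` K).
  apply: continuous_compact => //; apply: continuous_subspaceT => p.
  exact: cvg_snd.
exists (1 + `|M1| + `|M2|); first by rewrite -addrA ltr_pwDl.
move=> p Kp; apply/boxP; split; [apply: b1|apply: b2].
- by rewrite (le_lt_trans (ler_norm M1))// -addrA addrCA ltrDl ltr_pwDl.
- by exists p.
- by rewrite (le_lt_trans (ler_norm M2))// addrC ltrDl ltr_pwDl.
- by exists p.
Qed.

Lemma leb2_setX (A B : set (measurableTypeR R)) :
  measurable A -> measurable B ->
  leb2 R (A `*` B) = (@lebesgue_measure R A * @lebesgue_measure R B)%E.
Proof. by move=> mA mB; exact: product_measure1E. Qed.

Lemma leb2_box N : (leb2 R (box N) < +oo)%E.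
Proof.
rewrite /box leb2_setX//= !lebesgue_measure_itv/=.
by case: ifP => _; rewrite ?mule0 ?ltry// lte_mul_pinfty// ltry.
Qed.

End plane_topology.

(** * Integrals of derivatives on half-lines *)
Section half_lines.
Context {R : realType}.
Implicit Types (F : R -> R) (a b N : R).
Local Notation mu := (@lebesgue_measure R).

Lemma derive1_outside F N : (forall x, N < `|x| -> F x = 0) ->
  forall x, N < `|x| -> derive1 F x = 0.
Proof.
move=> F0 x Nx; rewrite derive1E.
rewrite (@near_eq_derive _ _ _ _ (cst 0)) ?derive_cst//.
have : {for x, continuous (fun y : R => `|y|)} by exact: norm_continuous.
move=> /cvgr_gt /(_ _ Nx); apply: filterS => y; exact: F0.
Qed.

Lemma Rintegral_derive1 F a b : (forall x, derivable F x 1) ->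
  continuous (derive1 F) -> a < b -> \int[mu]_(x in `[a, b]) derive1 F x = F b - F a.
Proof.
move=> dF cF ab.
have cF' : continuous F.
  by move=> x; apply: differentiable_continuous; exact/derivable1_diffP.
have dFab : derivable_oo_LRcontinuous F a b.
  split; first by move=> x _; exact: dF.
  - exact/cvg_at_right_filter/cF'.
  - exact/cvg_at_left_filter/cF'.
by rewrite /Rintegral (continuous_FTC2 ab (continuous_subspaceT cF) dFab).
Qed.

Lemma Rintegral_derive1_right F a N : (forall x, derivable F x 1) ->
  continuous (derive1 F) -> (forall x, N < `|x| -> F x = 0) ->
  \int[mu]_(x in `[a, +oo[) derive1 F x = - F a.
Proof.
move=> dF cF F0; pose b := 1 + `|a| + `|N|.
have [a_le N_le] := (ler_norm a, ler_norm N).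
have [a_ge0 N_ge0] := (normr_ge0 a, normr_ge0 N).
have ab : a < b by rewrite /b; lra.
have after x : b <= x -> N < `|x|.
  move=> bx; rewrite (lt_le_trans _ (ler_norm x))// (lt_le_trans _ bx)//.
  by rewrite /b; lra.
rewrite -[RHS]add0r -(F0 b)//; last exact: after.
rewrite -Rintegral_derive1// Rintegral_mkcond [RHS]Rintegral_mkcond.
congr Rintegral; apply/funext => x; rewrite !patchE !mem_setE !in_itv/= andbT.
case: (leP a x) => //= ax; case: (leP x b) => //= /ltW /after.
exact: derive1_outside.
Qed.

Lemma Rintegral_derive1_left F a N : (forall x, derivable F x 1) ->
  continuous (derive1 F) -> (forall x, N < `|x| -> F x = 0) ->
  \int[mu]_(x in `]-oo, a]) derive1 F x = F a.
Proof.
move=> dF cF F0; pose b := - (1 + `|a| + `|N|).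
have [a_le N_le] := (ler_norm (- a), ler_norm N).
have [a_ge0 N_ge0] := (normr_ge0 a, normr_ge0 N).
rewrite normrN in a_le.
have ab : b < a by rewrite /b; lra.
have before x : x <= b -> N < `|x|.
  move=> xb; rewrite -normrN (lt_le_trans _ (ler_norm (- x)))//.
  by move: xb; rewrite /b; lra.
rewrite -[RHS]subr0 -(F0 b)//; last exact: before.
rewrite -Rintegral_derive1// Rintegral_mkcond [RHS]Rintegral_mkcond.
congr Rintegral; apply/funext => x; rewrite !patchE !mem_setE !in_itv/=.
case: (leP x a) => //= ax; rewrite ?andbF ?andbT//.
case: (leP b x) => //= /ltW /before.
exact: derive1_outside.
Qed.

End half_lines.

(** * Test functions and Fubini's theorem *)
Section compact_support.
Context {R : realType}.
Implicit Types (mu : {measure set (plane R) -> \bar R}) (f phi : plane R -> R).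
Implicit Types D : set (plane R).

(** The uniform treatment of phi and of its partial derivatives: each of them
    is continuous and supported in one common box. *)
Definition C0_box (N : R) f := continuous f /\ forall p, ~ box N p -> f p = 0.

(** Local finiteness tested on boxes only; it implies finiteness on all compact
    sets, see compact_lty. *)
Definition finite_on_boxes mu := forall N : R, (mu (box N) < +oo)%E.

(** Only the part of D outside the box matters for the vanishing of f: this is
    what is available on the unbounded set wedge for functions that depend on
    time alone. *)
Lemma continuous_bounded_support_integrable mu N f D : finite_on_boxes mu ->
  continuous f -> (forall p, D p -> ~ box N p -> f p = 0) ->
  measurable D -> mu.-integrable D (EFin \o f).
Proof.
move=> mufin cf f0 mD; have mN := measurable_box N.
apply/(integrable_mkcond _ mD).
have -> : (EFin \o f) \_ D = (EFin \o f) \_ (D `&` box N).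
  apply/funext => p; rewrite !patchE in_setI; case: ifPn => //= /set_mem Dp.
  by case: ifPn => //; rewrite notin_setE/= => /(f0 _ Dp) ->.
apply/(integrable_mkcond _ (measurableI _ _ mD mN)).
apply: (integrableS mN) => //; first exact: measurableI.
apply: measurable_bounded_integrable => //.
  by apply: measurable_funTS; exact: continuous_measurable_plane.
have /compact_bounded [M [Mr fM]] : compact (f @` box N).
  apply: continuous_compact; last exact: compact_box.
  exact: continuous_subspaceT.
by exists M; split => // x Mx p /= Np; apply: fM => //; exists p.
Qed.

Lemma C0_box_integrable mu N f D : finite_on_boxes mu -> C0_box N f ->
  measurable D -> mu.-integrable D (EFin \o f).
Proof.
move=> mufin [cf f0].
by apply: (@continuous_bounded_support_integrable _ N) => // p _; exact: f0.
Qed.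

Lemma C1_0_box phi : C1_0 phi ->
  exists2 N : R, 0 < N & [/\ C0_box N phi, C0_box N (d_t phi) & C0_box N (d_x phi)].
Proof.
move=> [cphi dphi cdt cdx [K cK phi0]].
have [N N0 KN] := compact_sub_box cK; exists N => //.
have out p : ~ box N p -> phi p = 0 by move=> Np; apply: phi0 => /KN.
have outN t x : N < `|t| \/ N < `|x| -> phi (t, x) = 0.
  by move=> tx; apply: out => /boxP/= -[]; rewrite !leNgt; case: tx => ->.
have nbox p : ~ box N p -> N < `|p.1| \/ N < `|p.2|.
  move=> pN; apply: contrapT => /not_orP[/negP + /negP].
  by rewrite -!leNgt => p1 p2; apply: pN; apply/boxP.
split; split=> // -[t x] /nbox /= tx; rewrite /d_t /d_x/=.
- case: tx => [Nt|Nx]; last first.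
    rewrite (_ : (fun s => phi (s, x)) = cst 0) ?derive1_cst//.
    by apply/funext => s; apply: outN; right.
  by apply: derive1_outside Nt => s Ns; apply: outN; left.
- case: tx => [Nt|Nx].
    rewrite (_ : (fun y => phi (t, y)) = cst 0) ?derive1_cst//.
    by apply/funext => s; apply: outN; left.
  by apply: derive1_outside Nx => s Ns; apply: outN; right.
Qed.

End compact_support.

Section fubini.
Context {R : realType}.
Local Notation mu := (@lebesgue_measure R).
Implicit Types (f : plane R -> R) (D : set (plane R)).

Lemma leb2_finite_on_boxes : finite_on_boxes (leb2 R).
Proof. exact: leb2_box. Qed.

Lemma Rintegral_leb2_xt f D : measurable D ->
  (leb2 R).-integrable D (EFin \o f) ->
  \int[leb2 R]_(p in D) f p = \int[mu]_x \int[mu]_t (f \_ D) (t, x).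
Proof.
move=> mD fi; rewrite Rintegral_mkcond /Rintegral; congr fine.
have {}fi : (leb2 R).-integrable setT (EFin \o (f \_ D)).
  by rewrite -restrict_EFin; apply/(integrable_mkcond _ mD).
have mG := measurable_fubini_G fi.
rewrite -integral21_prod_meas1//; apply: ae_eq_integral => //.
  by apply/measurable_EFinP; apply: measurableT_comp mG.
apply: filterS (ae_integrable2 fi) => x intx _.
by rewrite /fubini_G/= fineK//; exact: integrable_fin_num.
Qed.

Lemma Rintegral_leb2_tx f D : measurable D ->
  (leb2 R).-integrable D (EFin \o f) ->
  \int[leb2 R]_(p in D) f p = \int[mu]_t \int[mu]_x (f \_ D) (t, x).
Proof.
move=> mD fi; rewrite Rintegral_mkcond /Rintegral; congr fine.
have {}fi : (leb2 R).-integrable setT (EFin \o (f \_ D)).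
  by rewrite -restrict_EFin; apply/(integrable_mkcond _ mD).
have mF := measurable_fubini_F fi.
rewrite -integral12_prod_meas1//; apply: ae_eq_integral => //.
  by apply/measurable_EFinP; apply: measurableT_comp mF.
apply: filterS (ae_integrable1 fi) => x intx _.
by rewrite /fubini_F/= fineK//; exact: integrable_fin_num.
Qed.

End fubini.

(** No integrability is assumed: when an extended integral is infinite, fine
    turns both sides into 0. *)
Lemma RintegralN {d} {T : measurableType d} {R : realType}
    (mu : {measure set T -> \bar R}) (D : set T) (f : T -> R) :
  \int[mu]_(x in D) - f x = - \int[mu]_(x in D) f x.
Proof.
rewrite /Rintegral [in LHS]integralE [in RHS]integralE.
rewrite (_ : (fun x => (- f x)%:E) = \- (EFin \o f))%E// funeposN funenegN.
set x := integral _ _ _; set y := integral _ _ _.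
by case: x y => [x| |] [y| |] //=; rewrite ?oppr0// opprB.
Qed.

Section weak_formulation.
Context {R : realType}.
Local Notation mu := (@lebesgue_measure R).
Implicit Types phi : plane R -> R.

Lemma Omega_barE : @Omega_bar R = `[0, +oo[%classic `*` `]-oo, 0]%classic.
Proof. by apply/seteqP; split => p /=; rewrite !in_itv/= andbT. Qed.

Lemma measurable_Omega_bar : measurable (@Omega_bar R).
Proof. by rewrite Omega_barE; apply: measurableX; exact: measurable_itv. Qed.

Lemma C1_0_slices phi : C1_0 phi -> exists N : R,
  [/\ forall t x, derivable (fun s => phi (s, x)) t 1,
      forall t x, derivable (fun y => phi (t, y)) x 1,
      forall x, continuous (derive1 (fun s => phi (s, x))),
      forall t, continuous (derive1 (fun y => phi (t, y))) &
      forall t x, N < `|t| \/ N < `|x| -> phi (t, x) = 0].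
Proof.
move=> phi1; have [N _ [[_ phi0] _ _]] := C1_0_box phi1.
have [_ dphi cdt cdx _] := phi1; exists N; split.
- by move=> t x; exact: (dphi (t, x)).1.
- by move=> t x; exact: (dphi (t, x)).2.
- move=> x t; apply: (@continuous_comp _ _ _ (fun s : R => (s, x)) (d_t phi)).
    by apply: (@cvg_pair _ _ _ _ (nbhs t) (nbhs x)); [exact: cvg_id|exact: cvg_cst].
  exact: cdt.
- move=> t x; apply: (@continuous_comp _ _ _ (fun y : R => (t, y)) (d_x phi)).
    by apply: (@cvg_pair _ _ _ _ (nbhs t) (nbhs x)); [exact: cvg_cst|exact: cvg_id].
  exact: cdx.
- move=> t x tx; apply: phi0 => /boxP/= -[].
  by rewrite !leNgt; case: tx => ->.
Qed.

(** Time lines enter the closed quadrant at t = 0 only. *)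
Lemma integral_d_t phi : C1_0 phi ->
  \int[leb2 R]_(p in @Omega_bar R) d_t phi p =
  - \int[mu]_(x in `]-oo, 0]) phi (0, x).
Proof.
move=> phi1; have [N N0 [_ dt0 _]] := C1_0_box phi1.
have [N' [dt _ cdt _ phi0]] := C1_0_slices phi1.
rewrite Rintegral_leb2_xt; last 2 first.
- exact: measurable_Omega_bar.
- by apply: C0_box_integrable leb2_finite_on_boxes dt0 measurable_Omega_bar.
rewrite -RintegralN [RHS]Rintegral_mkcond; congr Rintegral; apply/funext => x.
rewrite patchE mem_setE in_itv/=; case: ifPn => x0.
  rewrite -(@Rintegral_derive1_right _ (fun s => phi (s, x)) 0 N')//; last first.
    by move=> t Nt; apply: phi0; left.
  rewrite [RHS]Rintegral_mkcond; congr Rintegral; apply/funext => t.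
  rewrite !patchE; congr (if _ then _ else _).
  by apply/idP/idP; rewrite !inE /Omega_bar/= in_itv/= x0 andbT// => -[].
rewrite (_ : (fun t => _) = cst 0) ?Rintegral_cst ?mul0r//.
apply/funext => t; rewrite patchE; case: ifPn => // /set_mem[_ /=].
by rewrite (negbTE x0).
Qed.

(** Space lines leave the closed quadrant through the piston only. *)
Lemma integral_d_x phi : C1_0 phi ->
  \int[leb2 R]_(p in @Omega_bar R) d_x phi p =
  \int[mu]_(t in `[0, +oo[) phi (t, 0).
Proof.
move=> phi1; have [N N0 [_ _ dx0]] := C1_0_box phi1.
have [N' [_ dx _ cdx phi0]] := C1_0_slices phi1.
rewrite Rintegral_leb2_tx; last 2 first.
- exact: measurable_Omega_bar.
- by apply: C0_box_integrable leb2_finite_on_boxes dx0 measurable_Omega_bar.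
rewrite [RHS]Rintegral_mkcond; congr Rintegral; apply/funext => t.
rewrite patchE mem_setE in_itv/= andbT; case: ifPn => t0.
  rewrite -(@Rintegral_derive1_left _ (fun y => phi (t, y)) 0 N')//; last first.
    by move=> x Nx; apply: phi0; right.
  rewrite [RHS]Rintegral_mkcond; congr Rintegral; apply/funext => x.
  rewrite !patchE; congr (if _ then _ else _).
  by apply/idP/idP; rewrite !inE /Omega_bar/= in_itv/= t0// => -[].
rewrite (_ : (fun t => _) = cst 0) ?Rintegral_cst ?mul0r//.
apply/funext => x; rewrite patchE; case: ifPn => // /set_mem[/= + _].
by rewrite (negbTE t0).
Qed.

End weak_formulation.

(** * Integrals against derived measures *)
Section integral_lemmas.
Context {d} {T : measurableType d} {R : realType}.
Implicit Types (mu nu : {measure set T -> \bar R}) (D E W : set T) (f : T -> R).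

Lemma integrable_mrestr mu D E f (mD : measurable D) : measurable E ->
  measurable_fun E f -> mu.-integrable (E `&` D) (EFin \o f) ->
  (mrestr mu mD).-integrable E (EFin \o f).
Proof.
move=> mE mf /integrableP[_ fi]; apply/integrableP; split.
  exact/measurable_EFinP.
rewrite (ge0_negligible_integral (N := ~` D))//; last 3 first.
- exact: measurableC.
- by apply: measurableT_comp => //; exact/measurable_EFinP.
- by apply: eq_trans (measure0 mu); congr (mu _); rewrite setICl.
rewrite setDE setCK (eq_measure_integral mu)// => A mA AED.
by congr (mu _); apply: setIidl => t /AED[].
Qed.

Lemma Rintegral_mrestr mu D E f (mD : measurable D) : measurable E ->
  (mrestr mu mD).-integrable E (EFin \o f) ->
  \int[mrestr mu mD]_(x in E) f x = \int[mu]_(x in E `&` D) f x.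
Proof.
move=> mE fi; rewrite /Rintegral; congr fine.
rewrite (@negligible_integral _ _ _ _ _ (~` D))//; last 2 first.
- exact: measurableC.
- by rewrite /= /mrestr setICl measure0.
rewrite setDE setCK; apply: eq_measure_integral => A mA AED.
by congr (mu _); apply: setIidl => t /AED[].
Qed.

Lemma Rintegral_mscale mu (k : {nonneg R}) E f : measurable E ->
  mu.-integrable E (EFin \o f) ->
  \int[mscale k mu]_(x in E) f x = k%:num * \int[mu]_(x in E) f x.
Proof.
move=> mE fi; have mf := measurable_int _ fi.
have fp := integrable_pos_fin_num mE fi.
have fn := integrable_neg_fin_num mE fi.
rewrite /Rintegral integralE !ge0_integral_mscale//; last 2 first.
- exact: measurable_funeneg.
- exact: measurable_funepos.
rewrite [in RHS]integralE -muleBr ?fin_num_adde_defl ?fin_numN// fineM//.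
by rewrite fin_numB fp.
Qed.

Lemma Rintegral_measure_add mu nu E f : measurable E ->
  mu.-integrable E (EFin \o f) -> nu.-integrable E (EFin \o f) ->
  \int[measure_add mu nu]_(x in E) f x =
  \int[mu]_(x in E) f x + \int[nu]_(x in E) f x.
Proof.
move=> mE fmu fnu; rewrite /Rintegral integral_measure_add// fineD//.
- exact: integrable_fin_num.
- exact: integrable_fin_num.
Qed.

Lemma Rintegral_mzero E f : \int[@mzero _ T R]_(x in E) f x = 0.
Proof. by rewrite /Rintegral integral_measure_zero. Qed.

(** Change of variables for the image of a measure restricted to W, the image
    measure being known only through its values on measurable sets. *)
Lemma Rintegral_image {d'} {T' : measurableType d'} mu W
    (nu : {measure set T' -> \bar R}) (phi : T -> T') (D : set T') (f : T' -> R) :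
  measurable W -> measurable_fun setT phi ->
  (forall A, measurable A -> nu A = mu (phi @^-1` A `&` W)) ->
  measurable D -> measurable_fun setT f ->
  mu.-integrable (phi @^-1` D `&` W) (EFin \o (f \o phi)) ->
  \int[nu]_(y in D) f y = \int[mu]_(x in phi @^-1` D `&` W) f (phi x).
Proof.
move=> mW mphi nuE mD mf fi.
have mpre : measurable (phi @^-1` D).
  by rewrite -[X in measurable X]setTI; exact: mphi.
have {}fi : (mrestr mu mW).-integrable (phi @^-1` D) (EFin \o (f \o phi)).
  apply: integrable_mrestr => //; apply: measurable_funTS.
  exact: measurableT_comp.
rewrite -(Rintegral_mrestr mpre fi); congr fine.
have mEf : measurable_fun setT (EFin \o f) by exact/measurable_EFinP.
apply: eq_trans (integral_pushforward mphi mEf fi mD).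
by apply: eq_measure_integral => A mA _; exact: nuE.
Qed.

End integral_lemmas.

(** * The gas in flight and the gas stuck to the piston *)
Section measures.
Context {R : realType}.

(** The places where the gas which has reached the piston would be if it had
    gone on with unit velocity. At time t this is an interval of length t. *)
Definition wedge : set (plane R) := [set p | 0 <= p.2 <= p.1].

Lemma measurable_wedge : measurable wedge.
Proof.
have /(_ measurableT [set true]) : measurable_fun [set: plane R]
    (fun p => (0 <= p.2) && (p.2 <= p.1)).
  apply: measurable_and.
    by apply: measurable_fun_ler => //; exact: measurable_snd.
  by apply: measurable_fun_ler; [exact: measurable_snd|exact: measurable_fst].
by rewrite setTI; exact.
Qed.

Definition to_piston (p : plane R) : plane R := (p.1, 0).

Lemma measurable_to_piston : measurable_fun setT to_piston.
Proof. by apply: measurable_fun_pair => //; exact: measurable_fst. Qed.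

Definition bulk_measure : {measure set (plane R) -> \bar R} :=
  mrestr (leb2 R) (@measurable_Omega_bar R).

(** The weighted Dirac measure of weight t on the piston. Writing it as the
    image of the Lebesgue measure of the wedge reduces every integral against
    it to an integral in the plane. *)
Definition piston_measure (A : set (plane R)) : \bar R :=
  mrestr (leb2 R) measurable_wedge (to_piston @^-1` A).

Let piston_measure_pushforward : {measure set (plane R) -> \bar R}.
Proof.
refine (pushforward (mrestr (leb2 R) measurable_wedge) to_piston
  : {measure set (plane R) -> \bar R}).
exact: measurable_to_piston.
Defined.

(* The instance is transported from the image measure, so that piston_measure
   keeps an explicit formula as its body. *)
HB.instance Definition _ := isMeasure.Build _ _ _ piston_measure
  (measure0 piston_measure_pushforward)
  (measure_ge0 piston_measure_pushforward)
  (@measure_semi_sigma_additive _ _ _ piston_measure_pushforward).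

Lemma bulk_measureE A : bulk_measure A = leb2 R (A `&` @Omega_bar R).
Proof. by []. Qed.

Lemma piston_measureE A : piston_measure A = leb2 R (to_piston @^-1` A `&` wedge).
Proof. by []. Qed.

End measures.

Section finiteness.
Context {R : realType}.
Implicit Types (mu nu : {measure set (plane R) -> \bar R}) (N : R).
Implicit Types A K : set (plane R).

Lemma bulk_finite : finite_on_boxes (@bulk_measure R).
Proof.
move=> N; rewrite bulk_measureE; apply: le_lt_trans (leb2_box N).
have mN := measurable_box N.
by apply: le_measure; rewrite ?inE//; apply: measurableI => //;
  exact: measurable_Omega_bar.
Qed.

Lemma measurable_preimage_to_piston A : measurable A ->
  measurable (@to_piston R @^-1` A).
Proof.
by move=> mA; rewrite -[X in measurable X]setTI; exact: measurable_to_piston.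
Qed.

Lemma piston_finite : finite_on_boxes (@piston_measure R).
Proof.
move=> N; rewrite /= piston_measureE; apply: le_lt_trans (leb2_box N).
have mN := measurable_box N; apply: le_measure; rewrite ?inE//.
  apply: measurableI; last exact: measurable_wedge.
  exact: measurable_preimage_to_piston.
move=> p [/boxP[/= tN _] /andP[x0 xt]]; apply/boxP; split => //.
by rewrite ger0_norm// (le_trans xt)// (le_trans (ler_norm _)).
Qed.

Lemma finite_on_boxes_add mu nu : finite_on_boxes mu -> finite_on_boxes nu ->
  finite_on_boxes (measure_add mu nu).
Proof.
move=> fmu fnu N; suff : (measure_add mu nu (box N) < +oo)%E by [].
by rewrite measure_addE lte_add_pinfty.
Qed.

Lemma finite_on_boxes_mscale k mu :
  finite_on_boxes mu -> finite_on_boxes (mscale k mu).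
Proof. by move=> fmu N; rewrite /mscale/= lte_mul_pinfty. Qed.

Lemma finite_on_boxes_mzero : finite_on_boxes (@mzero _ (plane R) R).
Proof. by move=> N; rewrite /= /mzero ltry. Qed.

Lemma compact_lty mu K : finite_on_boxes mu -> compact K -> (mu K < +oo)%E.
Proof.
move=> fmu cK; have [N _ KN] := compact_sub_box cK.
apply: le_lt_trans (fmu N); apply: le_measure => //; rewrite inE.
- exact: compact_measurable_plane.
- exact: measurable_box.
Qed.

Lemma bounded_lty mu A K : finite_on_boxes mu -> measurable A -> compact K ->
  A `<=` K -> (mu A < +oo)%E.
Proof.
move=> fmu mA cK AK; apply: le_lt_trans (compact_lty fmu cK).
by apply: le_measure => //; rewrite inE//; exact: compact_measurable_plane.
Qed.

Lemma radonP mu : finite_on_boxes mu -> mu (~` @Omega_bar R) = 0%E -> radon mu.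
Proof. by move=> fmu mu0; split => // K; exact: compact_lty. Qed.

Lemma bulk_outside : bulk_measure (~` @Omega_bar R) = 0%E.
Proof. by rewrite bulk_measureE setICl measure0. Qed.

(** The piston measure does not see what happens off the half-line x = 0,
    t >= 0. *)
Lemma piston_off A : (forall t : R, 0 <= t -> ~ A (t, 0)) ->
  piston_measure A = 0%E.
Proof.
move=> A0; rewrite /= piston_measureE (_ : _ `&` _ = set0) ?measure0//.
apply/seteqP; split => // p [/= Ap /andP[x0 xt]].
by apply: A0 Ap; exact: le_trans xt.
Qed.

Lemma piston_outside : piston_measure (~` @Omega_bar R) = 0%E.
Proof. by apply: piston_off => t t0 out; apply: out; split => /=. Qed.

Definition piston_line : set (plane R) := [set p | p.2 = 0].

Let piston_lineE : piston_line = setT `*` [set 0].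
Proof. by apply/seteqP; split => p; rewrite /piston_line/=; tauto. Qed.

Lemma measurable_piston_line : measurable piston_line.
Proof. by rewrite piston_lineE; exact: measurableX. Qed.

Lemma leb2_piston_line : leb2 R piston_line = 0%E.
Proof. by rewrite piston_lineE leb2_setX// lebesgue_measure_set1 mule0. Qed.

Definition gas_side : set (plane R) := [set p | p.2 < 0].

Lemma measurable_gas_side : measurable gas_side.
Proof.
rewrite (_ : gas_side = setT `*` `]-oo, 0[%classic).
  by apply: measurableX => //; exact: measurable_itv.
by apply/seteqP; split => p; rewrite /gas_side /= in_itv/=; tauto.
Qed.

End finiteness.

Section piston_integral.
Context {R : realType}.
Local Notation mu := (@lebesgue_measure R).

Lemma integrable_wedge N (f : plane R -> R) : C0_box N f ->
  (leb2 R).-integrable wedge (EFin \o (f \o @to_piston R)).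
Proof.
move=> [cf f0].
apply: (@continuous_bounded_support_integrable _ _ N) => //.
- exact: leb2_finite_on_boxes.
- move=> p; apply: (@continuous_comp _ _ _ (@to_piston R) f).
    apply: (@cvg_pair _ _ _ _ (nbhs p.1) (nbhs (0 : R))).
      exact: cvg_fst.
    exact: cvg_cst.
  exact: cf.
- move=> p /andP[x0 xt] Np; apply: f0 => /boxP[/= tN _]; apply: Np; apply/boxP.
  by split=> //; rewrite ger0_norm// (le_trans xt)// (le_trans (ler_norm _)).
- exact: measurable_wedge.
Qed.

Lemma Rintegral_piston N (f : plane R -> R) : C0_box N f ->
  \int[piston_measure]_(p in @Omega_bar R) f p =
  \int[leb2 R]_(p in wedge) f (p.1, 0).
Proof.
move=> f0.
have preE : @to_piston R @^-1` @Omega_bar R `&` wedge = wedge.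
  by apply: setIidr => p /andP[x0 xt]; split => //=; exact: le_trans xt.
rewrite (@Rintegral_image _ _ _ _ _ (leb2 R) wedge _ (@to_piston R)) ?preE//.
- exact: measurable_wedge.
- exact: measurable_to_piston.
- exact: measurable_Omega_bar.
- by apply: continuous_measurable_plane; case: f0.
- exact: integrable_wedge f0.
Qed.

(** In the wedge, the time line through x starts at t = x, and there
    phi (t, 0) takes the value phi (x, 0). The variable x of the outer integral
    thus becomes the time variable of the result. *)
Lemma integral_piston_d_t phi : C1_0 phi ->
  \int[piston_measure]_(p in @Omega_bar R) d_t phi p =
  - \int[mu]_(t in `[0, +oo[) phi (t, 0).
Proof.
move=> phi1; have [N N0 [_ dt0 _]] := C1_0_box phi1.
have [N' [dt _ cdt _ phi0]] := C1_0_slices phi1.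
rewrite (Rintegral_piston dt0) Rintegral_leb2_xt; last 2 first.
- exact: measurable_wedge.
- exact: integrable_wedge dt0.
rewrite -RintegralN [RHS]Rintegral_mkcond; congr Rintegral; apply/funext => x.
rewrite patchE mem_setE in_itv/= andbT; case: ifPn => x0.
  rewrite -(@Rintegral_derive1_right _ (fun s => phi (s, 0)) x N')//; last first.
    by move=> t Nt; apply: phi0; left.
  rewrite [RHS]Rintegral_mkcond; congr Rintegral; apply/funext => t.
  rewrite !patchE; congr (if _ then _ else _).
  by apply/idP/idP; rewrite !inE /wedge/= in_itv/= x0 andbT.
rewrite (_ : (fun t => _) = cst 0) ?Rintegral_cst ?mul0r//.
apply/funext => t; rewrite patchE; case: ifPn => // /set_mem/andP[/= + _].
by rewrite (negbTE x0).
Qed.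

End piston_integral.

(** * Constant densities and the absence of jumps *)
Section constant_density.
Context {R : realType}.
Implicit Types (f : plane R -> R) (A V W S O : set (plane R)).

Lemma variation_measureE (mu : smeasure R) A :
  variation_measure mu A = (mu.1 A + mu.2 A)%E.
Proof. exact: measure_addE. Qed.

(** A density is determined almost everywhere by the values of the measure on
    bounded sets. It suffices to know them off the piston, which is a
    Lebesgue-null line; this is essential because the mass does charge the
    piston. *)
Lemma RN_derivative_cst (mu : smeasure R) (c : R) U f : open U ->
  (forall A N, measurable A -> A `<=` box N -> A `<=` @Omega_bar R ->
    A `<=` gas_side -> signed_value mu A = c * fine (leb2 R A)) ->
  RN_derivative_on (U `&` @Omega_bar R) mu (of_measure (leb2 R)) f ->
  {ae leb2 R, forall q, (U `&` @Omega_bar R) q -> f q = c}.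
Proof.
move=> oU muE [mf fE].
(* Densities are compared on bounded pieces, where they are integrable. *)
pose B (n : nat) : set (plane R) :=
  U `&` @Omega_bar R `&` gas_side `&` box n%:R.
have mneg := @measurable_gas_side R.
have mV : measurable (U `&` @Omega_bar R).
  apply: measurableI; last exact: measurable_Omega_bar.
  exact: open_measurable_plane.
have mB n : measurable (B n).
  apply: measurableI; last exact: measurable_box.
  exact: measurableI.
have varE : (variation_measure (of_measure (leb2 R)) : set (plane R) -> \bar R)
    = leb2 R.
  by apply/funext => A; rewrite variation_measureE/= /mzero adde0.
have step n : {ae leb2 R, forall q, B n q -> f q = c}.
  have BV : B n `<=` U `&` @Omega_bar R by move=> p [[]].
  have Bbox : B n `<=` box n%:R by move=> p [].
  have cB := @compact_box R n%:R.
  have [] := fE _ _ (mB n) cB Bbox BV; rewrite varE => fi _.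
  have mc : measurable_fun (B n) (EFin \o @cst (plane R) R c).
    by apply/measurable_EFinP; exact: measurable_cst.
  have := integral_ae_eq (mB n) fi mc.
  case.
    move=> E EB mE.
    have EV : E `<=` U `&` @Omega_bar R := subset_trans EB BV.
    have Ebox : E `<=` box n%:R := subset_trans EB Bbox.
    have [_] := fE _ _ mE cB Ebox EV.
    have EO : E `<=` @Omega_bar R by move=> p /EV[].
    have En : E `<=` gas_side by move=> p /EB[[_]].
    rewrite (muE _ _ mE Ebox EO En) /signed_integral/= Rintegral_mzero subr0.
    move=> cE; have fiE : (leb2 R).-integrable E (EFin \o f).
      exact: integrableS (mB n) mE EB fi.
    have Efin : leb2 R E \is a fin_num.
      rewrite ge0_fin_numE//.
      exact: bounded_lty leb2_finite_on_boxes mE cB Ebox.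
    rewrite integral_cst//= -(fineK Efin) -EFinM cE fineK//.
    exact: integrable_fin_num.
  move=> N [mN N0 BN]; exists N; split => // q /= nq; apply: BN => /= h.
  by apply: nq => /h -[].
have line : {ae leb2 R, forall q, q.2 <> 0 :> R}.
  exists piston_line; split; first exact: measurable_piston_line.
    exact: leb2_piston_line.
  by move=> q /= /contrapT.
have := ae_foralln step.
apply: (@filterS2 _ _ (ae_filter_ringOfSetsType (leb2 R))) line.
move=> q q0 Bq [Uq Oq].
have [n qn] : exists n : nat, box n%:R q.
  exists (Num.truncn (`|q.1| + `|q.2|)).+1.
  have := truncnS_gt (`|q.1| + `|q.2|).
  have := normr_ge0 q.1; have := normr_ge0 q.2.
  by move=> q2 q1 h; apply/boxP; lra.
apply: (Bq n); split => //; split => //=.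
by rewrite /gas_side/= lt_neqAle; case: Oq => _ ->; rewrite andbT; apply/eqP.
Qed.

(** The condition on a set S near q under which an essential limit along S is
    unique. *)
Definition thick_at (q : R * R) S := forall O, nbhs q O ->
  exists A, [/\ measurable A, A `<=` O `&` S & leb2 R A != 0%E].

Lemma ess_limit_cst (q : R * R) S W f (c l : R) : thick_at q S -> nbhs q W ->
  {ae leb2 R, forall y, W y -> f y = c} -> ess_limit S f q l -> l = c.
Proof.
move=> Sq Wq fc fl; apply: contrapT => /eqP lc.
have e0 : 0 < `|c - l| by rewrite normr_gt0 subr_eq0 eq_sym.
have [V [[oV Vq] Vl]] := fl _ e0.
have [|A [mA AWS]] := Sq (W `&` V).
  by apply: filterI => //; exact: open_nbhs_nbhs.
move=> /eqP; apply.
have : (leb2 R).-negligible A.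
  have : {ae leb2 R, forall y, ~ A y}.
    apply: (@filterS2 _ _ (ae_filter_ringOfSetsType (leb2 R))) fc Vl.
    move=> y yc yl /AWS[[Wy Vy] Sy].
    by have := yl Vy Sy; rewrite yc// ltxx.
  by apply: negligibleS => y Ay /=; exact.
by case=> N [mN N0 AN]; apply: (subset_measure0 mA mN AN).
Qed.

Section sides.
Variables (xi : R -> R) (t0 : R).
Hypothesis cxi : {for t0, continuous xi}.

(** Near a point of a continuous graph, the part of a small rectangle at
    vertical distance at least e / 2 from that point does not meet the graph.
    Such strips, above and below, give the thickness of both sides. *)
Lemma nbhs_graph O : nbhs (t0, xi t0) O -> exists r e : R,
  [/\ 0 < r, 0 < e & forall t x, `|t0 - t| < r -> `|xi t0 - x| < e ->
    O (t, x) /\ `|xi t0 - xi t| < e / 2].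
Proof.
move=> /nbhs_ballP[e /= e0 eO].
have /nbhs_ballP[d /= d0 dxi] : \forall t \near t0, `|xi t0 - xi t| < e / 2.
  by move/cvgrPdist_lt : cxi; apply; rewrite divr_gt0.
exists (Num.min e d), e; split => //; first by rewrite lt_min e0.
move=> t x; rewrite lt_min => /andP[te td] xe; split; last exact: dxi.
by apply: eO; split.
Qed.

Let rectangle_neq0 (r a b : R) : 0 < r -> a < b ->
  leb2 R (`]t0 - r, t0 + r[%classic `*` `]a, b[%classic) != 0%E.
Proof.
move=> r0 ab; rewrite leb2_setX//; try exact: measurable_itv.
rewrite !lebesgue_measure_itv/= !lte_fin ab ifT; last by lra.
by rewrite -!EFinB -EFinM eqe mulf_neq0//; lra.
Qed.

Lemma thick_at_left : thick_at (t0, xi t0) [set y | y.2 < xi y.1].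
Proof.
move=> O /nbhs_graph[r [e [r0 e0 rO]]].
exists (`]t0 - r, t0 + r[%classic `*` `]xi t0 - e, xi t0 - e / 2[%classic).
split; first by apply: measurableX; exact: measurable_itv.
  move=> [t x] [/=]; rewrite !in_itv/= => /andP[rt tr] /andP[ex xe].
  have [||Otx] := rO t x; [rewrite ltr_norml; apply/andP; split; lra..|].
  by rewrite ltr_norml => /andP[h1 h2]; split => //=; lra.
by apply: rectangle_neq0 => //; lra.
Qed.

Lemma thick_at_right : thick_at (t0, xi t0) [set y | xi y.1 < y.2].
Proof.
move=> O /nbhs_graph[r [e [r0 e0 rO]]].
exists (`]t0 - r, t0 + r[%classic `*` `]xi t0 + e / 2, xi t0 + e[%classic).
split; first by apply: measurableX; exact: measurable_itv.
  move=> [t x] [/=]; rewrite !in_itv/= => /andP[rt tr] /andP[ex xe].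
  have [||Otx] := rO t x; [rewrite ltr_norml; apply/andP; split; lra..|].
  by rewrite ltr_norml => /andP[h1 h2]; split => //=; lra.
by apply: rectangle_neq0 => //; lra.
Qed.

End sides.

Lemma open_Omega : open (@Omega R).
Proof.
have -> : @Omega R = fst @^-1` [set t | 0 < t] `&` snd @^-1` [set x | x < 0].
  by [].
apply: openI.
  by apply: open_comp; [move=> p _; exact: cvg_fst|exact: open_gt].
by apply: open_comp; [move=> p _; exact: cvg_snd|exact: open_lt].
Qed.

(** Constant states have no jump: along any curve both one-sided limits are the
    constant state itself, which contradicts the two states being distinct. *)
Lemma entropy_condition_cst gamma (M0 : \bar R) U (rho u : plane R -> R) (c v : R) :
  open U ->
  {ae leb2 R, forall q, (U `&` @Omega_bar R) q -> rho q = c} ->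
  (forall q, @Omega R q -> u q = v) ->
  entropy_condition_on gamma M0 (U `&` @Omega_bar R) rho u.
Proof.
move=> oU rhoc uv xi t0 l r q left right dxi _ [Uq _] Oq ll1 ll2 rl1 rl2 lr.
have cxi : {for t0, continuous xi}.
  apply: differentiable_continuous; apply/derivable1_diffP.
  exact: nbhs_singleton dxi.
have Wq : nbhs q (U `&` @Omega R).
  by apply: filterI; apply: open_nbhs_nbhs; split => //; exact: open_Omega.
have tl := thick_at_left cxi; have tr := thick_at_right cxi.
have rhoW : {ae leb2 R, forall y, (U `&` @Omega R) y -> rho y = c}.
  apply: (@filterS _ _ (ae_filter_ringOfSetsType (leb2 R))) rhoc.
  by move=> y yc [Uy [t x]]; apply: yc; split => //; split; exact: ltW.
have uW : {ae leb2 R, forall y, (U `&` @Omega R) y -> u y = v}.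
  by apply: aeW => y [_ /uv].
case: lr; rewrite [l]surjective_pairing [r]surjective_pairing.
rewrite (ess_limit_cst tl Wq rhoW ll1) (ess_limit_cst tl Wq uW ll2).
by rewrite (ess_limit_cst tr Wq rhoW rl1) (ess_limit_cst tr Wq uW rl2).
Qed.

End constant_density.

(** * The Radon-Nikodym derivative *)
Section stuck_gas.
Context {R : realType}.
Implicit Types (nu : {measure set (plane R) -> \bar R}) (A : set (plane R)).

Definition gas_velocity : plane R -> R := \1_gas_side.

Lemma measurable_gas_velocity D : measurable_fun D gas_velocity.
Proof. by apply: measurable_indic; exact: measurable_gas_side. Qed.

Lemma bulk_gas_side A : measurable A ->
  bulk_measure (gas_side `&` A) = bulk_measure A.
Proof.
move=> mA; rewrite !bulk_measureE; have mO := @measurable_Omega_bar R.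
have mN := measurable_gas_side.
set B := A `&` @Omega_bar R; rewrite -setIA -/B.
have mB : measurable B by exact: measurableI.
have mline := @measurable_piston_line R.
apply/eqP; rewrite eq_le; apply/andP; split.
  by apply: le_measure => //; rewrite inE//; exact: measurableI.
apply: (@le_trans _ _ (leb2 R ((gas_side `&` B) `|` piston_line))).
  apply: le_measure => //; rewrite ?inE//.
    by apply: measurableU => //; exact: measurableI.
  move=> p Bp; have [_ [_]] := Bp; rewrite le_eqVlt => /predU1P[p0|pn].
    by right.
  by left; split.
rewrite measureU0//; first exact: measurableI.
exact: leb2_piston_line.
Qed.

Lemma piston_gas_side A : piston_measure (gas_side `&` A) = 0%E.
Proof. by apply: piston_off => t _ [+ _]; rewrite /gas_side/= ltxx. Qed.

Lemma Rintegral_gas_velocity nu A : measurable A ->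
  \int[nu]_(p in A) gas_velocity p = fine (nu (gas_side `&` A)).
Proof.
move=> mA; rewrite /Rintegral; congr fine; apply: integral_indic => //.
exact: measurable_gas_side.
Qed.

(** All measures of the solution consist of a bulk part, moving with velocity 1,
    and of a part carried by the piston, at rest. Integrating the velocity
    against such a measure therefore leaves the bulk part. *)
Lemma RN_derivative_gas_velocity (nu : smeasure R) :
  finite_on_boxes nu.1 -> finite_on_boxes nu.2 ->
  (forall A, measurable A -> nu.1 (gas_side `&` A) = bulk_measure A) ->
  (forall A, measurable A -> nu.2 (gas_side `&` A) = 0%E) ->
  RN_derivative_on (@Omega_bar R) (of_measure bulk_measure) nu gas_velocity.
Proof.
move=> fin1 fin2 nu1 nu2; split; first exact: measurable_gas_velocity.
move=> A K mA cK AK AO; split.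
  apply: measurable_bounded_integrable => //.
  - apply: bounded_lty mA cK AK; exact: finite_on_boxes_add.
  - exact: measurable_gas_velocity.
  - exists 1; split => // M M1 p _ /=; rewrite (le_trans _ (ltW M1))//.
    by rewrite /gas_velocity indicE; case: (_ \in _); rewrite ?normr1 ?normr0.
rewrite /signed_value /signed_integral !Rintegral_gas_velocity// nu1// nu2//.
Qed.

End stuck_gas.

(** * The measure solution *)
Section solution.
Context {R : realType} (gamma : R) (M0 : \bar R) (w : R).
Hypotheses (gamma_gt0 : 0 < gamma) (w0 : 0 <= w).

(** The constant pressure of the undisturbed gas. *)
Let P0 : R := pressure gamma M0 1.

Let P0_le0 : 0 <= - P0.
Proof.
by rewrite /P0 /pressure powR1 mulr1 opprK divr_ge0 ?sqr_ge0 ?ltW.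
Qed.

(** The momentum flux 1 + P0 which arrives at the piston has to be balanced by
    the force w and by the rate a at which momentum is stored there. The sign
    of a is not known, hence the Jordan decomposition of momentum. *)
Let a := 1 + P0 - w.
Let apos_ge0 : 0 <= Num.max a 0. Proof. by rewrite le_max lexx orbT. Qed.
Let aneg_ge0 : 0 <= Num.max (- a) 0. Proof. by rewrite le_max lexx orbT. Qed.

Definition gas_mass : {measure set (plane R) -> \bar R} :=
  measure_add bulk_measure piston_measure.

Local Notation measure2 := {measure set (plane R) -> \bar R}.

Definition momentum : smeasure R :=
  ([the measure2 of
     measure_add bulk_measure (mscale (NngNum apos_ge0) piston_measure)],
   [the measure2 of mscale (NngNum aneg_ge0) piston_measure]).

Definition pressure_measure : smeasure R :=
  ([the measure2 of mzero],
   [the measure2 of mscale (NngNum P0_le0) bulk_measure]).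

Lemma gas_mass_finite : finite_on_boxes gas_mass.
Proof. apply: finite_on_boxes_add; [exact: bulk_finite|exact: piston_finite]. Qed.

Lemma momentum_finite :
  finite_on_boxes momentum.1 /\ finite_on_boxes momentum.2.
Proof.
split; last by apply: finite_on_boxes_mscale; exact: piston_finite.
apply: finite_on_boxes_add; first exact: bulk_finite.
by apply: finite_on_boxes_mscale; exact: piston_finite.
Qed.

Lemma gas_massE A : gas_mass A = (bulk_measure A + piston_measure A)%E.
Proof. exact: measure_addE. Qed.

Lemma momentum1E A : momentum.1 A =
  (bulk_measure A + (Num.max a 0)%:E * piston_measure A)%E.
Proof. exact: measure_addE. Qed.

Lemma momentum2E A : momentum.2 A = ((Num.max (- a) 0)%:E * piston_measure A)%E.
Proof. by []. Qed.

Lemma radon_bulk : radon (@bulk_measure R).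
Proof. exact: radonP bulk_finite bulk_outside. Qed.

Lemma radon_mzero : radon (@mzero _ (plane R) R).
Proof. exact: radonP finite_on_boxes_mzero _. Qed.

Lemma radon_gas_mass : radon gas_mass.
Proof.
apply: radonP gas_mass_finite _; rewrite gas_massE.
by rewrite bulk_outside piston_outside adde0.
Qed.

Lemma signed_radon_of_measure nu : radon nu -> @signed_radon R (of_measure nu).
Proof.
move=> rnu; split => //; first exact: radon_mzero.
by exists set0 => //; rewrite measure0.
Qed.

(** A Hahn decomposition depends on the sign of a: for a negative one the
    negative part lives on the piston line, which the bulk does not charge. *)
Lemma signed_radon_momentum : @signed_radon R momentum.
Proof.
have [fin1 fin2] := momentum_finite; split.
- apply: radonP fin1 _; rewrite momentum1E.
  by rewrite bulk_outside piston_outside mule0 adde0.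
- by apply: radonP fin2 _; rewrite momentum2E piston_outside mule0.
- have [a0|a0] := leP 0 a.
    exists set0 => //; rewrite measure0 momentum2E.
    by rewrite max_r ?oppr_le0// mul0e.
  exists piston_line; first exact: measurable_piston_line.
  rewrite momentum1E momentum2E max_r ?ltW// mul0e adde0 bulk_measureE.
  rewrite piston_off ?mule0; last by move=> t _ /=; exact.
  split => //; apply: (subset_measure0 _ measurable_piston_line) leb2_piston_line => //.
  by apply: measurableI measurable_piston_line measurable_Omega_bar.
Qed.

Lemma signed_radon_pressure_measure : @signed_radon R pressure_measure.
Proof.
split; first exact: radon_mzero.
- apply: radonP; first by apply: finite_on_boxes_mscale; exact: bulk_finite.
  by rewrite /= /mscale bulk_outside mule0.
- by exists setT => //; rewrite setCT measure0.
Qed.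

Lemma abs_cont_bulk (nu : smeasure R) :
  (forall A, measurable A -> (bulk_measure A <= nu.1 A)%E) ->
  abs_cont (of_measure bulk_measure) nu.
Proof.
move=> bulk_le; apply/null_content_dominatesP => A mA.
move=> nuA0; have nu0 : variation_measure nu A = 0%E := nuA0.
suff : variation_measure (of_measure bulk_measure) A = 0%E by [].
move: nu0; rewrite !variation_measureE/= /mzero adde0 => nu0.
apply/eqP; rewrite eq_le measure_ge0 andbT.
by rewrite -nu0 (le_trans (bulk_le _ mA))// leeDl.
Qed.

Lemma Rintegral_bulk (f : plane R -> R) :
  \int[bulk_measure]_(p in @Omega_bar R) f p =
  \int[leb2 R]_(p in @Omega_bar R) f p.
Proof.
rewrite /Rintegral (eq_measure_integral (leb2 R))// => A mA AO.
by rewrite bulk_measureE (setIidl AO).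
Qed.

Lemma pairing_of_measure (nu : measure2) f :
  pairing (of_measure nu) f = \int[nu]_(p in @Omega_bar R) f p.
Proof. by rewrite /pairing /signed_integral/= Rintegral_mzero subr0. Qed.

Lemma pairing_bulk f :
  pairing (of_measure bulk_measure) f = \int[leb2 R]_(p in @Omega_bar R) f p.
Proof. by rewrite pairing_of_measure Rintegral_bulk. Qed.

Section test_function.
Variables (N : R) (f : plane R -> R).
Hypothesis f0 : C0_box N f.

Let integrable_f nu : finite_on_boxes nu ->
  nu.-integrable (@Omega_bar R) (EFin \o f).
Proof.
by move=> finnu; exact: C0_box_integrable finnu f0 (@measurable_Omega_bar R).
Qed.

Lemma pairing_gas_mass : pairing (of_measure gas_mass) f =
  \int[leb2 R]_(p in @Omega_bar R) f p +
  \int[piston_measure]_(p in @Omega_bar R) f p.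
Proof.
rewrite pairing_of_measure -Rintegral_bulk.
apply: Rintegral_measure_add; first exact: measurable_Omega_bar.
- by apply: integrable_f; exact: bulk_finite.
- by apply: integrable_f; exact: piston_finite.
Qed.

Lemma pairing_momentum : pairing momentum f =
  \int[leb2 R]_(p in @Omega_bar R) f p +
  a * \int[piston_measure]_(p in @Omega_bar R) f p.
Proof.
have mO := @measurable_Omega_bar R.
have fpi : piston_measure.-integrable (@Omega_bar R) (EFin \o f).
  by apply: integrable_f; exact: piston_finite.
have fmscale k : (mscale k piston_measure).-integrable (@Omega_bar R) (EFin \o f).
  by apply: integrable_f; apply: finite_on_boxes_mscale; exact: piston_finite.
have fbulk : bulk_measure.-integrable (@Omega_bar R) (EFin \o f).
  by apply: integrable_f; exact: bulk_finite.
rewrite /pairing /signed_integral.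
have -> := Rintegral_measure_add mO fbulk (fmscale (NngNum apos_ge0)).
have -> := Rintegral_mscale (NngNum apos_ge0) mO fpi.
have -> := Rintegral_mscale (NngNum aneg_ge0) mO fpi.
rewrite Rintegral_bulk -addrA -mulrBl/=; congr (_ + _ * _).
by rewrite /Num.max; case: (ltP a); case: (ltP (- a)); lra.
Qed.

Lemma pairing_pressure_measure : pairing pressure_measure f =
  P0 * \int[leb2 R]_(p in @Omega_bar R) f p.
Proof.
have mO := @measurable_Omega_bar R.
have fbulk : bulk_measure.-integrable (@Omega_bar R) (EFin \o f).
  by apply: integrable_f; exact: bulk_finite.
rewrite /pairing /signed_integral.
have -> := Rintegral_mscale (NngNum P0_le0) mO fbulk.
by rewrite Rintegral_mzero Rintegral_bulk sub0r /= mulNr opprK.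
Qed.

End test_function.

(** The mass which leaves the gas through the piston is the mass gained by the
    piston: the boundary term of d_x phi cancels the one of the piston measure,
    and the term at t = 0 cancels the initial datum. *)
Lemma mass_balance phi : C1_0 phi ->
  pairing (of_measure gas_mass) (d_t phi) +
  pairing (of_measure bulk_measure) (d_x phi) +
  \int[@lebesgue_measure R]_(x in `]-oo, 0]) (rho_init R * phi (0, x)) = 0.
Proof.
move=> phi1; have [N N0 [_ dt0 dx0]] := C1_0_box phi1.
rewrite (pairing_gas_mass dt0) pairing_bulk integral_d_t// integral_d_x//.
rewrite integral_piston_d_t//.
rewrite [X in _ + X](@eq_Rintegral _ _ _ _ _ (fun x => phi (0, x))); last first.
  by move=> x _; rewrite /rho_init mul1r.
by rewrite subrK addNr.
Qed.

Lemma integrable_piston_trace phi : C1_0 phi ->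
  (@lebesgue_measure R).-integrable `[0, +oo[ (EFin \o (fun t => phi (t, 0))).
Proof.
move=> phi1; have [N [dt _ _ _ phi0]] := C1_0_slices phi1.
have fi : (@lebesgue_measure R).-integrable `[0, N]
    (EFin \o (fun t => phi (t, 0))).
  apply: continuous_compact_integrable; first exact: segment_compact.
  apply: continuous_subspaceT => t; apply: differentiable_continuous.
  exact/derivable1_diffP.
apply/integrable_mkcond; first exact: measurable_itv.
rewrite (_ : _ \_ _ = (EFin \o (fun t => phi (t, 0))) \_ `[0, N]%classic).
  by move: fi => /integrable_mkcond; apply; exact: measurable_itv.
apply/funext => t; rewrite !patchE !mem_setE !in_itv/= andbT.
have [t0|//] := leP 0 t; case: (leP t N) => //= Nt.
by rewrite phi0//; left; rewrite ger0_norm.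
Qed.

(** The boundary terms on the piston add up to 1 + P0 - a - w, which vanishes by
    the choice of a. *)
Lemma momentum_balance phi : C1_0 phi ->
  pairing momentum (d_t phi) + pairing (of_measure bulk_measure) (d_x phi) +
  pairing pressure_measure (d_x phi) - piston_dirac (cst w) phi +
  \int[@lebesgue_measure R]_(x in `]-oo, 0]) (u_init (-1) * phi (0, x)) = 0.
Proof.
move=> phi1; have [N N0 [_ dt0 dx0]] := C1_0_box phi1.
rewrite (pairing_momentum dt0) pairing_bulk (pairing_pressure_measure dx0).
rewrite integral_d_t// integral_d_x// integral_piston_d_t//.
rewrite [piston_dirac _ _]RintegralZl; last 2 first.
- exact: measurable_itv.
- exact: integrable_piston_trace.
rewrite [X in _ + X](@eq_Rintegral _ _ _ _ _ (fun x => phi (0, x))); last first.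
  by move=> x _; rewrite /u_init opprK mul1r.
rewrite /a; set X := Rintegral _ _ _; set Y := Rintegral _ _ _.
by move: X Y => X Y; lra.
Qed.

(** Any constant nonnegative force w is balanced by some storage rate. *)
Lemma measure_solution_stuck_gas :
  measure_solution gamma M0 (-1) gas_mass gas_velocity (cst w).
Proof.
split=> //; first exact: radon_gas_mass.
  move=> T T0; apply: continuous_compact_integrable.
    exact: segment_compact.
  by apply: continuous_subspaceT => t; exact: cvg_cst.
exists (of_measure bulk_measure), momentum, (of_measure bulk_measure),
  pressure_measure.
have gas_side_mass A : measurable A ->
    gas_mass (gas_side `&` A) = bulk_measure A.
  by move=> mA; rewrite gas_massE piston_gas_side adde0 bulk_gas_side.
split.
- split; [|exact: signed_radon_momentum| |exact: signed_radon_pressure_measure];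
    by apply: signed_radon_of_measure; exact: radon_bulk.
- split.
  + apply: abs_cont_bulk => A mA.
    by rewrite [leRHS]gas_massE leeDl.
  + apply: abs_cont_bulk => A mA.
    by rewrite momentum1E leeDl// mule_ge0.
  + apply: RN_derivative_gas_velocity => //; first exact: gas_mass_finite.
    exact: finite_on_boxes_mzero.
  + have [fin1 fin2] := momentum_finite.
    apply: RN_derivative_gas_velocity => // A mA.
      by rewrite momentum1E piston_gas_side mule0 adde0 bulk_gas_side.
    by rewrite momentum2E piston_gas_side mule0.
- by move=> phi phi1; split; [exact: mass_balance|exact: momentum_balance].
- move=> p U rho Pd Op [oU Up] V rhoV PdV.
  have rho1 : {ae leb2 R, forall q, V q -> rho q = 1}.
    apply: RN_derivative_cst rhoV => // A N mA AN AO An.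
    rewrite /signed_value/= subr0 mul1r.
    have -> := gas_massE A.
    rewrite -[A in piston_measure A](setIidr An) piston_gas_side adde0.
    by rewrite bulk_measureE (setIidl AO).
  have PdP0 : {ae leb2 R, forall q, V q -> Pd q = P0}.
    apply: RN_derivative_cst PdV => // A N mA AN AO An.
    rewrite /signed_value/= /mzero /mscale/= sub0r.
    rewrite bulk_measureE (setIidl AO) fineM//.
      by rewrite /= mulNr opprK.
    rewrite ge0_fin_numE//; apply: (@bounded_lty _ _ _ (box N)) => //.
      exact: leb2_finite_on_boxes.
    exact: compact_box.
  split.
    apply: (@filterS2 _ _ (ae_filter_ringOfSetsType (leb2 R))) rho1 PdP0.
    by move=> q r1 p1 Vq; rewrite r1// p1//; split.
  apply: (@entropy_condition_cst _ _ _ _ _ _ 1 1) rho1 _ => // q [_ q0].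
  by rewrite /gas_velocity indicE mem_set.
Qed.

End solution.

Unset Implicit Arguments.
Set Strict Implicit.

Theorem theorem2p1 (R : realType) (gamma : R) (M0 : \bar R)
    (gamma_gt0 : 0 < gamma) (gamma_le1 : gamma <= 1) (M0_gt0 : (0 < M0)%E) :
  ((exists rho u : plane R -> R, shock_wave_solution gamma M0 rho u) ->
     (0 < M0 < (Num.sqrt 2 * (1 + gamma) `^ (- (1 / 2)))%:E)%E) /\
  (((Num.sqrt 2 * (1 + gamma) `^ (- (1 / 2)))%:E <= M0)%E ->
     exists (varrho : {measure set (plane R) -> \bar R}) (u : plane R -> R)
       (w_p : R -> R), measure_solution gamma M0 (-1) varrho u w_p).
Proof.
have threshold := Mach_lt_threshold gamma_gt0 M0_gt0.
split=> [[rho [u [rho1 [sigma [s0 _ RH _]]]]]|].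
  by rewrite M0_gt0 threshold; exact: shock_strength RH.
rewrite leNgt threshold -leNgt => c_le.
(* The flux u^2 / 2 + enthalpy of the incoming gas, which is nonnegative
   because M0 is at least the threshold. *)
pose w : R := 1 / 2 + enthalpy gamma M0 1.
have w_ge0 : 0 <= w.
  by rewrite /w /enthalpy powR1 mulr1; lra.
exists gas_mass, gas_velocity, (cst w).
exact: measure_solution_stuck_gas.
Qed.
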